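(* Let $\mathsf{L}$ be a simplicial complex such that $\eta(\mathsf{L})<\infty$. For a fixed complete simplicial complex $\mathsf{K}=2^V$ with $|V|\geq 2$, we have $$\eta(\mathsf{L})\leq \mathrm{IC}(\mathsf{L};\mathsf{K}).$$ Furthermore, equality holds whenever $\mathsf{L}$ is a pure simplicial complex with $\dim\mathsf{L}=\dim\mathsf{K}$.
   Context: A simplicial complex is an abstract simplicial complex: a set $\mathsf{K}$ of subsets (simplices) of a vertex set $V(\mathsf{K})=\bigcup\mathsf{K}$ such that $F\in\mathsf{K}$ and $G\subseteq F$ imply $G\in\mathsf{K}$. The dimension of a simplex $F$ is $|F|-1$, and $\dim\mathsf{K}$ is the maximum dimension of its simplices. A facet is a simplex that is maximal with respect to inclusion; a facet is non-unitary if it has at least two vertices. The number of facets of $\mathsf{L}$ is denoted $\eta(\mathsf{L})$. A simplicial complex $\mathsf{L}$ is pure if $\dim\mathsf{L}<\infty$ and every facet has dimension $\dim\mathsf{L}$. It is complete if it equals the set $2^V$ of all subsets of its vertex set $V$. A subcomplex of $\mathsf{K}$ is a simplicial complex contained in $\mathsf{K}$. The union of simplicial complexes is the union of their vertex sets and of their sets of simplices. A simplicial map $f:\mathsf{L}\to\mathsf{K}$ is a map $f:V(\mathsf{L})\to V(\mathsf{K})$ such that $f(F)\in\mathsf{K}$ whenever $F\in\mathsf{L}$; it is injective if it is injective on vertices. A facet simplicial map is a simplicial map $f:\mathsf{L}\to\mathsf{K}$ such that $f(F)$ is a non-unitary facet of $\mathsf{K}$ whenever $F$ is a non-unitary facet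 of $\mathsf{L}$. The injective facet-complexity $\mathrm{IC}(\mathsf{L};\mathsf{K})$ is the least positive integer $k$ such that there exist subcomplexes $\mathsf{L}_1,\ldots,\mathsf{L}_k$ of $\mathsf{L}$ with $\mathsf{L}=\mathsf{L}_1\cup\cdots\cup\mathsf{L}_k$ and, for each $i$, an injective facet simplicial map $f_i:\mathsf{L}_i\to\mathsf{K}$; it is $\infty$ if no such $k$ exists.
   Formalization: The inequality is proved assuming L has at most one unitary (one-vertex) facet; without this it fails: for L two isolated points, η(L)=2 but IC(L;2^V)=1. The equality clause is unchanged. *)

(* Defs.v *)
From mathcomp Require Import all_boot all_order all_algebra.
From mathcomp Require Import finmap.
From mathcomp Require Import boolp classical_sets functions cardinality.
From mathcomp Require Import constructive_ereal.

Set Implicit Arguments.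
Unset Strict Implicit.
Unset Printing Implicit Defensive.

Import Order.TTheory GRing.Theory Num.Theory.
Local Open Scope ring_scope.
Local Open Scope classical_set_scope.
Local Open Scope ereal_scope.

(* Cardinalities, dimensions and IC all take values in the extended integers
   \bar int. All infinite cardinalities are identified with +oo. *)
Definition ecard (T : choiceType) (A : set T) : \bar int :=
  if `[< finite_set A >] then (#|` fset_set A|%:Z)%:E else +oo.

(* The simplices are arbitrary, possibly infinite, subsets of an ambient type T;
   neither a nonempty simplex nor the empty simplex is required to exist. *)
Record scomplex (T : choiceType) := SComplex {
  simplices : set (set T);
  _ : forall F G : set T, simplices F -> G `<=` F -> simplices G }.

Lemma full_complex_closed (T : choiceType) (V F G : set T) :
  [set F | F `<=` V] F -> G `<=` F -> [set F | F `<=` V] G.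
Proof. by move=> FV GF; apply: subset_trans FV. Qed.

(* The complete complex 2^V. *)
Definition full_complex (T : choiceType) (V : set T) : scomplex T :=
  SComplex (@full_complex_closed T V).

Section complexes.
Variable T : choiceType.
Implicit Types (F : set T) (K L : scomplex T).

Definition vertices K : set T := \bigcup_(F in simplices K) F.

Definition simplex_dim F : \bar int := ecard F - 1.

(* The supremum is a maximum as soon as it is finite; it is -oo for the complex
   without simplices and -1 for the complex {set0}. *)
Definition complex_dim K : \bar int :=
  supremum -oo [set simplex_dim F | F in simplices K].

Definition facet K : set (set T) :=
  [set F | simplices K F /\ forall G, simplices K G -> F `<=` G -> G = F].

Definition non_unitary_facet K : set (set T) :=
  [set F | facet K F /\ 2 <= ecard F].

(* Facet simplicial maps put no condition on these, so a subcomplex that consists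
   of several isolated points can be mapped injectively into K in one piece:
   two isolated points L have eta L = 2, but IC(L; 2^V) = 1 when 2 <= |V|. *)
Definition unitary_facet K : set (set T) :=
  [set F | facet K F /\ ecard F = 1].

Definition eta K : \bar int := ecard (facet K).

Definition pure_complex K : Prop :=
  complex_dim K < +oo /\ forall F, facet K F -> simplex_dim F = complex_dim K.

End complexes.

Section maps.
Variables T U : choiceType.
Implicit Types (L : scomplex T) (K : scomplex U) (f : T -> U).

(* A map V(L) -> V(K) is represented by a function T -> U on the ambient types,
   of which only the values on V(L) are ever used. That f sends V(L) into V(K)
   follows from the condition on the simplices {v}. *)
Definition simplicial_map L K f : Prop :=
  forall F, simplices L F -> simplices K (f @` F).

Definition facet_simplicial_map L K f : Prop :=
  simplicial_map L K f /\
  forall F, non_unitary_facet L F -> non_unitary_facet K (f @` F).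

Definition injective_facet_simplicial_map L K f : Prop :=
  facet_simplicial_map L K f /\ set_inj (vertices L) f.

Definition IC_cover L K (k : nat) : Prop :=
  (0 < k)%N /\
  exists Ls : 'I_k -> scomplex T,
    [/\ forall i, simplices (Ls i) `<=` simplices L,
        simplices L = \bigcup_i simplices (Ls i) &
        forall i, exists f, injective_facet_simplicial_map (Ls i) K f].

(* The infimum of a nonempty set of positive integers is its least element, and
   the infimum of the empty set is +oo. *)
Definition IC L K : \bar int :=
  infimum +oo [set (k%:Z)%:E | k in IC_cover L K].

End maps.

(* Main.v *)
(* If an injective facet simplicial map is defined on a subcomplex containing a
   non-unitary facet F of L, then it maps F onto V, hence F already contains all
   vertices of the subcomplex. As L has at most one unitary facet, no member of
   a cover contains two facets of L, which bounds the size of the cover from below by the number of facets.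
   If L is pure of dimension |V| - 1, every simplex lies in a facet, because the
   dimensions are bounded, and the full complexes on the facets cover L; each is
   mapped to 2^V by a bijection from the facet onto V. *)

From HB Require Import structures.
Require Import Defs.
From mathcomp Require Import all_boot all_order all_algebra finmap.
From mathcomp Require Import boolp classical_sets functions cardinality.
From mathcomp Require Import constructive_ereal.

Set Implicit Arguments.
Unset Strict Implicit.
Unset Printing Implicit Defensive.

Local Open Scope ring_scope.
Local Open Scope classical_set_scope.
Local Open Scope ereal_scope.

Import Order.TTheory GRing.Theory Num.Theory.
Local Open Scope card_scope.

Section extrema.
Variables (d : Order.disp_t) (T : porderType d).
Implicit Types (x m : T) (A : set T).

Lemma supremum_max x A m : A m -> ubound A m -> supremum x A = m.
Proof.
move=> Am mub; have mA : supremums A m by split=> // y; exact.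
rewrite /supremum ifF; last by apply/eqP=> A0; rewrite A0 in Am.
by apply: is_subset1_supremums (mA); exact: xgetI mA.
Qed.

Lemma infimum_min x A m : A m -> lbound A m -> infimum x A = m.
Proof.
move=> Am mlb; have mA : infimums A m by split=> // y; exact.
rewrite /infimum ifF; last by apply/eqP=> A0; rewrite A0 in Am.
by apply: is_subset1_infimums (mA); exact: xgetI mA.
Qed.

(** The default [x] is returned both for an empty set and for a set without supremum, so any other
    value certifies a genuine supremum. *)
Lemma supremum_ubound x A : supremum x A != x -> ubound A (supremum x A).
Proof.
rewrite /supremum; case: ifP => [_|_]; first by rewrite eqxx.
by case: xgetP => [y _ [] //|]; rewrite eqxx.
Qed.

End extrema.

Section ecard.
Variable T : choiceType.
Implicit Types A B : set T.

Lemma ecardE A n : A #= `I_n -> ecard A = n%:Z%:E.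
Proof.
move=> An; rewrite /ecard (card_fset_set An) asboolT //.
by apply/finite_setP; exists n.
Qed.

Lemma ecard_fin A : ecard A < +oo -> exists n, A #= `I_n.
Proof. by rewrite /ecard; case: asboolP => // /finite_setP. Qed.

Lemma ecard_infty A : infinite_set A -> ecard A = +oo.
Proof. by move=> Ainf; rewrite /ecard asboolF. Qed.

Lemma ecard_trichotomy A : [\/ A = set0, ecard A = 1 | 2 <= ecard A].
Proof.
have [/finite_setP[n An]|Ainf] := pselect (finite_set A); last first.
  by constructor 3; rewrite ecard_infty// leey.
case: n An => [|[|n]] An; last by constructor 3; rewrite (ecardE An) lee_fin.
- constructor 1; apply/eqP; rewrite -(@card_eq0 _ nat).
  by move: An; rewrite II0.
- by constructor 2; rewrite (ecardE An).
Qed.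

Lemma le_ecard A B : A `<=` B -> ecard A <= ecard B.
Proof.
move=> AB; have [Bfin|Binf] := pselect (finite_set B); last first.
  by rewrite (ecard_infty Binf) leey.
have Afin := sub_finite_set AB Bfin.
rewrite /ecard !asboolT// lee_fin lez_nat.
by apply: fsubset_leq_card; move: AB; rewrite fset_set_sub.
Qed.

Lemma sub_card_eq A B n : A #= `I_n -> B #= `I_n -> A `<=` B -> A = B.
Proof.
move=> An Bn AB.
have Afin : finite_set A by apply/finite_setP; exists n.
have Bfin : finite_set B by apply/finite_setP; exists n.
apply: fset_set_inj => //; apply/eqP.
rewrite eqEfcard; apply/andP; split; first by move: AB; rewrite fset_set_sub.
by rewrite (card_fset_set An) (card_fset_set Bn).
Qed.

End ecard.

Lemma card_eq_bij_fun (T U : choiceType) (A : set T) (B : set U) :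
  B !=set0 -> A #= B -> exists2 f : T -> U, f @` A = B & set_inj A f.
Proof.
(* A point of [B] makes [U] pointed, which provides a value for the total function outside [A]. *)
move=> [u _]; pose Up : pointedType := HB.pack U (isPointed.Build U u).
move=> /(@card_set_bijP _ Up)[f [fA injf fsurj]]; exists f => //.
by apply/seteqP; split=> [_ [x Ax <-]|]; [exact: fA|exact: fsurj].
Qed.

Section complexes.
Variable T : choiceType.
Implicit Types (L : scomplex T) (F G V : set T).

Lemma simplices_sub L F G : simplices L F -> G `<=` F -> simplices L G.
Proof. by case: L => S Scl; exact: Scl. Qed.

Lemma facet_full_complex V : facet (full_complex V) = [set V].
Proof.
apply/seteqP; split=> [F [FV Fmax]|_ ->].
  by apply/esym/Fmax.
by split=> [//|G GV VG]; apply/seteqP.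
Qed.

Lemma complex_dim_full V : complex_dim (full_complex V) = simplex_dim V.
Proof.
apply: supremum_max; first by exists V.
by move=> _ [F FV <-]; apply: leeD2r; exact: le_ecard.
Qed.

(** Among the simplices containing [F], one of greatest cardinality is maximal for inclusion; the
    bound [n] ensures that it exists. *)
Lemma bounded_sub_facet L n F :
  (forall G, simplices L G -> ecard G <= n%:Z%:E) ->
  simplices L F -> exists2 G, facet L G & F `<=` G.
Proof.
move=> Ln LF.
have Lcard G : simplices L G -> exists2 m, G #= `I_m & (m <= n)%N.
  move=> /Ln Gn.
  have [m Gm] := ecard_fin (le_lt_trans Gn (ltry _)).
  by exists m => //; move: Gn; rewrite (ecardE Gm) lee_fin lez_nat.
pose P m := `[< exists G, [/\ simplices L G, F `<=` G & G #= `I_m] >].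
have exP : exists m, P m.
  by have [m Fm _] := Lcard F LF; exists m; apply/asboolP; exists F; split.
have leP m : P m -> (m <= n)%N.
  move=> /asboolP[G [/Lcard[m' Gm' m'n] _ Gm]].
  by have /card_eq_II -> := card_eq_trans (card_esym Gm) Gm'.
have [m /asboolP[G [LG FG Gm]] mmax] := ex_maxnP exP leP.
exists G => //; split=> // H LH GH; apply/esym.
have [m' Hm' _] := Lcard H LH.
apply: (@sub_card_eq _ _ _ m) => //.
suff <- : m' = m by [].
apply/eqP; rewrite eqn_leq mmax; last first.
  by apply/asboolP; exists H; split=> //; exact: subset_trans GH.
by have := le_ecard GH; rewrite (ecardE Gm) (ecardE Hm') lee_fin lez_nat.
Qed.

End complexes.

Section covers.
Variables T U : choiceType.
Implicit Types (L : scomplex T) (V : set U).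

Lemma IC_cover_ge L V k :
  (forall F G, unitary_facet L F -> unitary_facet L G -> F = G) ->
  IC_cover L (full_complex V) k -> facet L #<= `I_k.
Proof.
move=> uniq_unitary [k0 [Ls [LsL LE Lsf]]].
(* Maximality passes to subcomplexes, so the facet condition on the map of a piece applies to facets
   of [L]. *)
have facetLs i F : facet L F -> simplices (Ls i) F -> facet (Ls i) F.
  by move=> [_ Fmax] LsF; split=> // G /LsL; exact: Fmax.
(* As [f] maps [F] onto [V], the image of a vertex [y] of [G] is also the image of some [x] in [F];
   injectivity gives [y = x], so [G] lies in [F]. *)
have absorb i F G : facet L F -> 2 <= ecard F -> facet L G ->
    simplices (Ls i) F -> simplices (Ls i) G -> F = G.
  move=> LF F2 [_ Gmax] LsF LsG.
  have [f [[fsimp ffacet] finj]] := Lsf i.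
  have fFV : f @` F = V.
    have /ffacet[] : non_unitary_facet (Ls i) F by split=> //; exact: facetLs.
    by rewrite facet_full_complex.
  apply: Gmax => [|y Gy]; first exact: LsL LsF.
  have [x Fx fxy] : (f @` F) (f y).
    by rewrite fFV; apply: (fsimp G LsG); exists y.
  by rewrite -(finj x y)// inE; [exists F|exists G].
have same i F G : facet L F -> facet L G ->
    simplices (Ls i) F -> simplices (Ls i) G -> F = G.
  move=> LF LG LsF LsG.
  (* An empty facet lies in every simplex, so it is the only facet; two one-vertex facets, which
     facet maps do not constrain, are equal by hypothesis. *)
  have [F0|F1|F2] := ecard_trichotomy F; last exact: absorb LsF LsG.
    by case: LF => LF Fmax; apply/esym/Fmax; [exact: LG.1|rewrite F0].
  have [G0|G1|G2] := ecard_trichotomy G; last by apply/esym; exact: absorb LsG LsF.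
    by case: LG => _ Gmax; apply: Gmax; [exact: LF.1|rewrite G0].
  exact: uniq_unitary.
(* [c] picks a piece containing each facet, with an arbitrary index elsewhere; by [same] it is
   injective on facets. *)
have /choice[c cP] : forall F, exists i, facet L F -> simplices (Ls i) F.
  move=> F; have [LF|nLF] := pselect (facet L F); last by exists (Ordinal k0).
  by move: (LF.1); rewrite LE => -[i _ LsF]; exists i.
have cinj : {in facet L &, injective c}.
  move=> F G; rewrite !inE => LF LG cFG.
  by apply: (same (c F)) => //; [|rewrite cFG]; exact: cP.
have := subset_card_le (@subsetT _ (c @` facet L)).
by rewrite (card_le_eql (inj_card_eq cinj)) -(card_le_eqr card_II).
Qed.

Lemma IC_cover_facets L V n k : (1 < n)%N -> V #= `I_n ->
  (forall F, simplices L F -> exists2 G, facet L G & F `<=` G) ->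
  (forall F, facet L F -> F #= `I_n) ->
  (0 < k)%N -> facet L #= `I_k -> IC_cover L (full_complex V) k.
Proof.
move=> n2 Vn Lfacet facetn k0 Lk; split=> //.
(* [e] only serves to show that [facet L] is nonempty, as needed for the enumeration [g] in the
   other direction. *)
have [e eL _] := card_eq_bij_fun (ex_intro _ 0%N k0 : `I_k !=set0) Lk.
have [g gE _] : exists2 g : nat -> set T, g @` `I_k = facet L & set_inj `I_k g.
  apply: card_eq_bij_fun; last exact: card_esym.
  have : `I_k !=set0 by exists 0%N.
  by rewrite -eL => -[_ [F LF _]]; exists F.
have gL (i : 'I_k) : facet L (g i) by rewrite -gE; exists (i : nat) => /=.
exists (fun i => full_complex (g i)); split=> [i F Fg||i].
- exact: simplices_sub (gL i).1 Fg.
- apply/seteqP; split=> [F /Lfacet[G LG FG]|F [i _ Fg]].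
    by move: LG; rewrite -gE => -[i ik gi]; exists (Ordinal ik) => //=; rewrite gi.
  exact: simplices_sub (gL i).1 Fg.
- have V0 : V !=set0.
    apply/set0P/eqP=> V0; have := ecardE Vn.
    by rewrite V0 (@ecardE _ _ 0%N) ?II0// => -[] n0; rewrite -n0 in n2.
  have [|f fV finj] := card_eq_bij_fun V0 (_ : g i #= V).
    exact: card_eq_trans (facetn _ (gL i)) (card_esym Vn).
  exists f; split; last first.
    move=> x y; rewrite !inE => -[F Fg Fx] [G Gg Gy].
    by apply: finj; rewrite inE; [exact: Fg|exact: Gg].
  split=> [F Fg|F [+ _]].
    by rewrite /= -fV; exact: image_subset.
  rewrite facet_full_complex => ->; rewrite fV.
  split; first by rewrite facet_full_complex.
  by rewrite (ecardE Vn) lee_fin.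
Qed.

Lemma IC_min (K : scomplex U) L : (exists k, IC_cover L K k) ->
  exists k, [/\ IC_cover L K k, IC L K = k%:Z%:E &
    forall j, IC_cover L K j -> (k <= j)%N].
Proof.
move=> [k0 Lk0].
have exP : exists k, `[< IC_cover L K k >] by exists k0; apply/asboolP.
have [k /asboolP Lk kmin] := ex_minnP exP.
have {}kmin j : IC_cover L K j -> (k <= j)%N by move=> Lj; apply/kmin/asboolP.
exists k; split=> //; apply: infimum_min; first by exists k.
by move=> _ [j Lj <-]; rewrite lee_fin lez_nat; exact: kmin.
Qed.

End covers.

Theorem proposition3p19 (T U : choiceType) (L : scomplex T) (V : set U)
    (eta_fin : eta L < +oo) (V_ge2 : 2 <= ecard V) :
  ((forall F G : set T, unitary_facet L F -> unitary_facet L G -> F = G) ->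
     eta L <= IC L (full_complex V)) /\
  (pure_complex L -> complex_dim L = complex_dim (full_complex V) ->
     eta L = IC L (full_complex V)).
Proof.
have [k Lk] := ecard_fin eta_fin.
have lower : (forall F G, unitary_facet L F -> unitary_facet L G -> F = G) ->
    eta L <= IC L (full_complex V).
  move=> uniq_unitary.
  have [exk|nexk] := pselect (exists j, IC_cover L (full_complex V) j).
    have [j [/(IC_cover_ge uniq_unitary) + -> _]] := IC_min exk.
    by rewrite (card_le_eql Lk) card_le_II /eta (ecardE Lk) lee_fin lez_nat.
  (* Without any finite cover the infimum takes its default value [+oo]. *)
  suff -> : IC L (full_complex V) = +oo by rewrite leey.
  rewrite /IC; set ks := [set _ | _ in _].
  have -> : ks = set0 by rewrite -subset0 => x [j Lj _]; apply: nexk; exists j.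
  by rewrite /infimum eqxx.
split=> // -[dimfin Lpure]; rewrite complex_dim_full => dimLV.
(* Purity makes the dimension of [L] finite, and [V] has the same dimension. *)
have [n Vn] : exists n, V #= `I_n.
  apply: ecard_fin; move: dimfin; rewrite dimLV /simplex_dim.
  by case: (ecard V) => [r _| |_]; rewrite ?ltry ?ltNyr.
have n2 : (1 < n)%N by move: V_ge2; rewrite (ecardE Vn) lee_fin.
have dimn : simplex_dim V = n%:Z%:E - 1 by rewrite /simplex_dim (ecardE Vn).
have Ln F : simplices L F -> ecard F <= n%:Z%:E.
  move=> LF; have : simplex_dim F <= complex_dim L.
    (* The dimension of [L] is the integer [n - 1], hence not the default [-oo]. *)
    apply: supremum_ubound; last by exists F.
    by rewrite -/(complex_dim L) dimLV dimn.
  by rewrite dimLV dimn leeD2rE.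
have Lfacet F : simplices L F -> exists2 G, facet L G & F `<=` G.
  exact: bounded_sub_facet Ln.
have facetn F : facet L F -> F #= `I_n.
  move=> LF; have [m Fm] := ecard_fin (le_lt_trans (Ln F LF.1) (ltry _)).
  suff <- : m = n by [].
  have := Lpure F LF; rewrite dimLV dimn /simplex_dim (ecardE Fm).
  by move=> [] /addIr [].
(* Without facets there would be no simplices, and the dimension would be [-oo] instead of
   [n - 1]. *)
have k0 : (0 < k)%N.
  rewrite lt0n; apply/eqP=> k0; move: Lk; rewrite k0 II0 card_eq0 => /eqP L0.
  have S0 : simplices L = set0.
    by rewrite -subset0 => F /Lfacet[G]; rewrite L0.
  by move: dimLV; rewrite dimn /complex_dim S0 image_set0 supremum0.
have Lcover := IC_cover_facets n2 Vn Lfacet facetn k0 Lk.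
apply/eqP; rewrite eq_le lower/=.
  have [|j [_ -> /(_ k Lcover) jk]] := @IC_min _ _ (full_complex V) L.
    by exists k.
  by rewrite /eta (ecardE Lk) lee_fin lez_nat.
(* The uniqueness condition of [lower] holds vacuously: every facet has [n] vertices, with [n] at
   least 2. *)
move=> F G [/facetn Fn F1]; move: F1; rewrite (ecardE Fn) => -[] n1.
by rewrite n1 in n2.
Qed.
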